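(* The following statements are equivalent for every uncountable regular cardinal $\kappa$: (1) $\kappa$ is weakly compact; (2) every partial order of cardinality at most $\kappa$ satisfying the $\kappa$-chain condition is $\kappa$-stationarily layered; (3) every partial order satisfying the $\kappa$-chain condition is $\kappa$-stationarily layered.
   Context: A suborder $\mathbb{Q}\subseteq\mathbb{P}$ is a regular suborder if the inclusion map preserves incompatibility and every maximal antichain of $\mathbb{Q}$ is maximal in $\mathbb{P}$. $\mathrm{Reg}_\kappa(\mathbb{P})$ is the set of regular suborders of $\mathbb{P}$ of cardinality less than $\kappa$. A partial order $\mathbb{P}$ is $\kappa$-stationarily layered if $\mathrm{Reg}_\kappa(\mathbb{P})$ is stationary in $\mathcal{P}_\kappa(\mathbb{P})$, where stationarity is in Jech's sense: $S\subseteq\mathcal{P}_\kappa(A)$ is stationary if it meets every $C\subseteq\mathcal{P}_\kappa(A)$ that is $\subseteq$-cofinal in $\mathcal{P}_\kappa(A)$ and closed under unions of $\subseteq$-increasing chains of length less than $\kappa$. *)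

(* Defs.v *)
From mathcomp Require Import all_boot all_order.
From mathcomp Require Import all_classical.

Set Implicit Arguments.
Unset Strict Implicit.
Unset Printing Implicit Defensive.

Local Open Scope classical_set_scope.
Local Open Scope card_scope.
Local Open Scope order_scope.

Definition card_lt (T U : Type) (A : set T) (B : set U) : Prop :=
  A #<= B /\ ~ (B #<= A).

(* Cardinals are initial ordinals: an ordinal is (the order type of) a
   well-ordered type [K]; it is a cardinal when no proper initial segment is
   equinumerous with it. The ordinals below [K] are then the initial segments
   [set i | i < a] for [a : K], and the cardinality of [K] is [set: K]. *)
Section Cardinals.
Context {d : Order.disp_t} (K : orderType d).

Definition is_cardinal : Prop :=
  wochoice.well_order (<=%O : rel K) /\
  forall a : K, card_lt [set i : K | i < a] [set: K].

Definition uncountable : Prop := ~ countable [set: K].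

Definition cofinal (A : set K) : Prop :=
  forall x : K, exists2 y : K, A y & x <= y.

(* Regularity means cf(K) = K, i.e. no cofinal subset is smaller than K;
   finite K are not excluded here, but by [uncountable]. *)
Definition regular : Prop :=
  forall A : set K, cofinal A -> A #= [set: K].

(* K is uncountable and K --> (K)^2_2. A colouring of the two-element subsets
   {x, y} of K is given by its values on the pairs x < y. *)
Definition weakly_compact : Prop :=
  uncountable /\
  forall f : K -> K -> bool, exists (H : set K) (b : bool),
    H #= [set: K] /\ forall x y : K, H x -> H y -> x < y -> f x y = b.

End Cardinals.

Section Stationary.
Context {d : Order.disp_t} (K : orderType d) (T : Type).

Definition Pkappa : set (set T) := [set X | card_lt X [set: K]].

Definition cofinal_in_Pkappa (C : set (set T)) : Prop :=
  forall X : set T, Pkappa X -> exists2 Y : set T, C Y & X `<=` Y.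

(* An increasing chain of length a < K is a family [x] of which only the values
   at indices i < a matter. The empty chain (a = 0) is excluded: otherwise
   every closed set would have to contain the empty set. *)
Definition chain_closed (C : set (set T)) : Prop :=
  forall (a : K) (x : K -> set T),
    [set i : K | i < a] !=set0 ->
    (forall i : K, i < a -> C (x i)) ->
    (forall i j : K, i <= j -> j < a -> x i `<=` x j) ->
    C (\bigcup_(i in [set i : K | i < a]) x i).

Definition club (C : set (set T)) : Prop :=
  [/\ C `<=` Pkappa, cofinal_in_Pkappa C & chain_closed C].

Definition stationary (S : set (set T)) : Prop :=
  forall C : set (set T), club C -> S `&` C !=set0.

End Stationary.

(* Suborders of [P] are subsets [Q : set P] with the induced order; [P] itself
   is [set: P]. *)
Section Suborders.
Context {d : Order.disp_t} {P : porderType d}.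

Definition compatible (Q : set P) (p q : P) : Prop :=
  exists r : P, [/\ Q r, r <= p & r <= q].

Definition antichain (Q A : set P) : Prop :=
  A `<=` Q /\
  forall p q : P, A p -> A q -> p <> q -> ~ compatible Q p q.

Definition maximal_antichain (Q A : set P) : Prop :=
  antichain Q A /\
  forall B : set P, antichain Q B -> A `<=` B -> B = A.

Definition regular_suborder (Q : set P) : Prop :=
  (forall p q : P, Q p -> Q q ->
     ~ compatible Q p q -> ~ compatible [set: P] p q) /\
  forall A : set P, maximal_antichain Q A -> maximal_antichain [set: P] A.

End Suborders.

Section Layered.
Context {d : Order.disp_t} (K : orderType d).
Context {d' : Order.disp_t} (P : porderType d').

Definition chain_condition : Prop :=
  forall A : set P, antichain [set: P] A -> card_lt A [set: K].

Definition Reg : set (set P) :=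
  [set Q | regular_suborder Q /\ card_lt Q [set: K]].

Definition stationarily_layered : Prop := stationary K Reg.

End Layered.

(* Main.v *)
(* Weak compactness implies layering: given K subsets of K, compare the points
   of K by the lexicographic order of their membership sequences; a homogeneous
   set for this colouring is almost contained in each of the subsets or in its
   complement. Hence any K predicates are decided by a K-complete filter, and
   pushing this filter forward along a minimal unbounded function makes a given
   family of K regressive functions bounded. If no member of the club C is
   regular in P, build a continuous increasing chain (Q_a) in C such that Q_a+1
   contains some p_a without reduct in Q_a: below each q in Q_a there is some
   h_a(q) in Q_a incompatible with p_a. Modulo the filter h_a(q) is a constant
   h(q). A maximal antichain A of values of h is smaller than K by the chain
   condition, so A is incompatible with a single p_a; but p_a lies in the union
   of the chain, where A is maximal.

   Conversely, if f has no homogeneous set of size K, the Erdos-Rado tree of f on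
   K has no chain of size K, and the poset of its finite antichains satisfies the
   chain condition. The antichains contained in M, for M small and closed under
   predecessors and immediate successors, form a club. None of them is regular:
   for t outside M, any condition q in M compatible with {t} can be extended by a
   node of M below t that lies beyond the splitting of t from the elements of q. *)
From HB Require Import structures.
Require Import Defs.
From mathcomp Require Import all_boot all_order finmap.
From mathcomp Require Import all_classical.

Set Implicit Arguments.
Unset Strict Implicit.
Unset Printing Implicit Defensive.
Import Order.TTheory.
Local Open Scope classical_set_scope.
Local Open Scope card_scope.
Local Open Scope order_scope.

(** * The poset of finite independent sets *)

Definition finindep (T : choiceType) (R : T -> T -> Prop) : Type :=
  {A : {fset T} | `[< forall x y, x \in A -> y \in A -> ~ R x y >]}.

Section FinIndep.
Variables (T : choiceType) (R : T -> T -> Prop).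
Local Notation P := (finindep R).

HB.instance Definition _ := [Choice of P by <:].

Definition finindep_le (p q : P) : bool := (val q `<=` val p)%fset.

Lemma finindep_le_refl : reflexive finindep_le.
Proof. by move=> p; exact: fsubset_refl. Qed.

Lemma finindep_le_anti : antisymmetric finindep_le.
Proof. by move=> p q; rewrite andbC -eqEfsubset => /eqP/val_inj. Qed.

Lemma finindep_le_trans : transitive finindep_le.
Proof. by move=> q p r pq qr; exact: fsubset_trans qr pq. Qed.

HB.instance Definition _ := Order.Le_isPOrder.Build (Order.Disp tt tt) P
  finindep_le_refl finindep_le_anti finindep_le_trans.

Lemma finindepP (p : P) x y : x \in val p -> y \in val p -> ~ R x y.
Proof. by have /asboolP := valP p; exact. Qed.

Lemma finindep_enum_inj : injective (fun p : P => enum_fset (val p)).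
Proof.
move=> p q pq; apply/val_inj/fsetP => x.
by have : (x \in enum_fset (val p)) = (x \in enum_fset (val q)) by rewrite pq.
Qed.

Lemma finindep_leP (p q : P) : p <= q <-> {subset val q <= val p}.
Proof. by split=> /fsubsetP. Qed.

Lemma finindep_ex (A : {fset T}) :
  (forall x y, x \in A -> y \in A -> ~ R x y) -> exists p : P, val p = A.
Proof. by move=> /asboolP AP; exists (exist _ A AP). Qed.

Lemma finindep_compatible (p q : P) :
  (forall x y, x \in val p -> y \in val q -> ~ R x y /\ ~ R y x) ->
  compatible [set: P] p q.
Proof.
move=> pq; have [|r rE] := @finindep_ex (val p `|` val q)%fset.
  move=> x y; rewrite !in_fsetU => /orP[xp|xq] /orP[yp|yq].
  - exact: finindepP yp.
  - by have [] := pq _ _ xp yq.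
  - by have [] := pq _ _ yp xq.
  - exact: finindepP yq.
by exists r; split=> //; apply/finindep_leP => x xp; rewrite rE in_fsetU xp ?orbT.
Qed.

End FinIndep.

Lemma compatible_sym {d : Order.disp_t} (P : porderType d) (Q : set P) (p q : P) :
  compatible Q p q -> compatible Q q p.
Proof. by move=> [r [? ? ?]]; exists r. Qed.

(** * Small sets *)

Lemma card_leTP T U (B : set U) :
  [set: T] #<= B <-> exists f : T -> U, (forall x, B (f x)) /\ injective f.
Proof.
split=> [/card_leP[f]|[f [fB fi]]].
  exists (fun x => sval (f (exist _ x (mem_set I)))); split.
    by move=> x; exact: set_mem (valP (f _)).
  move=> x y /val_inj fxy; have := 'inj_f (mem_set I) (mem_set I) fxy.
  by move=> [].
apply: (card_le_trans (B := range f)).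
  by have := inj_card_eq (A := [set: T]) (in2W fi); rewrite card_eq_le => /andP[].
by apply: subset_card_le => _ [x _ <-].
Qed.

Lemma card_le_inj T U (A : set T) (B : set U) (f : T -> U) :
  (forall x, A x -> B (f x)) ->
  (forall x y, A x -> A y -> f x = f y -> x = y) -> A #<= B.
Proof.
move=> fB fi; apply: (card_le_trans (B := f @` A)).
  have : f @` A #= A.
    by apply: inj_card_eq => x y; rewrite !inE; exact: fi.
  by rewrite card_eq_le => /andP[].
by apply: subset_card_le => _ [x Ax <-]; exact: fB.
Qed.

Lemma maximal_independent T (R : T -> T -> Prop) (D : set T) :
  (forall x y, R x y -> R y x) ->
  exists A : set T, [/\ A `<=` D,
    forall x y, A x -> A y -> x <> y -> ~ R x y &
    forall x, D x -> A x \/ exists2 a, A a & R x a].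
Proof.
move=> Rsym.
have [|A [[AD Aind] Amax]] := @Zorn_bigcup T
   [set A | A `<=` D /\ forall x y, A x -> A y -> x <> y -> ~ R x y].
  move=> F FP Ftot; split=> [x [X /FP[XD _] /XD]//|x y [X FX Xx] [Y FY Yy]].
  have [XY|YX] := Ftot _ _ FX FY.
    by have [_] := FP _ FY; apply=> //; exact: XY.
  by have [_] := FP _ FX; apply=> //; exact: YX.
exists A; split=> // x Dx; apply: contrapT => /not_orP[nAx nR].
apply: (Amax (x |` A)).
  by split=> [y Ay|/(_ x (or_introl erefl))//]; right.
split=> [y [->//|/AD//]|y z [->|Ay] [->|Az] // yz Ryz].
- by apply: nR; exists z.
- by apply: nR; exists y => //; exact: Rsym.
- exact: Aind Ryz.
Qed.

Lemma well_order_wf (T : eqType) (R : rel T) :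
  wochoice.well_order R -> well_founded (fun x y => ~~ R y x).
Proof.
move=> Rwo x; apply: contrapT => nx.
have [|m [[/asboolP nAm mmin] _]] :=
    Rwo [pred y | `[< ~ Acc (fun x y => ~~ R y x) y >]].
  by exists x; apply/asboolP.
apply: nAm; constructor => y; apply: contraNP => ny.
by apply: mmin; apply/asboolP.
Qed.

Section RegularCardinal.
Context {d : Order.disp_t} (K : orderType d).
Hypothesis cardK : is_cardinal K.
Hypothesis uncK : uncountable K.
Hypothesis regK : regular K.

Lemma lt_wf : well_founded (fun x y : K => x < y).
Proof.
move=> x; elim: (well_order_wf cardK.1 x) => {}x _ IH.
by constructor => y; rewrite ltNge => /IH.
Qed.

Lemma ex_least (A : set K) : A !=set0 -> exists2 m, A m & forall x, A x -> m <= x.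
Proof.
move=> [x Ax].
have [|m [[/asboolP Am mmin] _]] := cardK.1 [pred y : K | `[< A y >]].
  by exists x; apply/asboolP.
by exists m => // y Ay; apply: mmin; apply/asboolP.
Qed.

(** Only the second half of [card_lt]; the first half follows from it by [small_card_le]. *)
Definition small T (A : set T) : Prop := ~ ([set: K] #<= A).

Lemma sub_small T (A B : set T) : A `<=` B -> small B -> small A.
Proof. by move=> AB sB KA; apply: sB; exact: card_le_trans KA (subset_card_le AB). Qed.

Lemma small_inj T U (A : set T) (B : set U) (f : T -> U) :
  (forall x, A x -> B (f x)) ->
  (forall x y, A x -> A y -> f x = f y -> x = y) -> small B -> small A.
Proof.
by move=> fB fi sB KA; apply: sB; exact: card_le_trans KA (card_le_inj fB fi).
Qed.

Lemma small_image T U (A : set T) (f : T -> U) : small A -> small (f @` A).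
Proof. by move=> sA KfA; apply: sA; exact: card_le_trans KfA (card_image_le _ _). Qed.

Lemma small_segment (a : K) : small [set i : K | i < a].
Proof. by have [_] := cardK.2 a. Qed.

(* Recursion along the well-order "first rk, then an arbitrary well-order of T". *)
Lemma card_le_rank T (A : set T) (rk : T -> K) :
  (forall a, small (A `&` [set x | rk x <= a])) -> A #<= [set: K].
Proof.
move=> Asm.
have [R Rwo] := wochoice.well_ordering_principle {classic T}.
have Rchain := wochoice.withinW Rwo (A := mem predT).
have Rtot (x y : {classic T}) : R x y || R y x by exact: (wochoice.wo_chainW Rchain).
have Ranti (x y : {classic T}) : R x y && R y x -> x = y.
  exact: (wochoice.wo_chain_antisymmetric Rchain).
pose prec (x y : T) := rk x < rk y \/ rk x = rk y /\ ~~ R y x.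
have precwf : well_founded prec.
  move=> x; move: {2}(rk x) (erefl (rk x)) => a.
  elim: (lt_wf a) x => {}a _ IHa x.
  elim: (well_order_wf Rwo x) => {}x _ IHx rkx.
  constructor => y [|[ryx nR]].
    by rewrite rkx => ya; exact: (IHa _ ya y erefl).
  by apply: (IHx y nR); rewrite ryx.
have prect x y : x <> y -> prec x y \/ prec y x.
  move=> xy; rewrite /prec; case: (ltgtP (rk x) (rk y)) => [||e].
  - by left; left.
  - by right; left.
  have [Rxy|Rxy] := boolP (R x y); last by right; right.
  have [Ryx|Ryx] := boolP (R y x); last by left; right.
  by case: xy; apply: Ranti; rewrite Rxy.
pose body x (rec : forall y, prec y x -> K) :=
  [set k : K | forall y (h : prec y x), A y -> rec y h <> k].
have [->|/set0P[x0 Ax0]] := eqVneq A set0; first exact: card_ge0.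
pose k0 := rk x0.
pose F : T -> K := Fix precwf (fun=> K) (fun x rec => xget k0 (body x rec)).
have FE x : F x = xget k0 [set k | forall y, prec y x -> A y -> F y <> k].
  rewrite /F Fix_eq// => {}x f g fg; congr xget; apply/seteqP.
  by split=> k /= H y h Ay; have := H y h Ay; rewrite fg.
have Fnew x y : A y -> prec y x -> F y <> F x.
  move=> Ay yx; rewrite (FE x); move: y yx Ay; case: xgetP => // none; exfalso.
  (* Were no value left, [F] would map the predecessors of [x] in [A] onto [K]; but their rank is at
     most [rk x], so they form a small set. *)
  apply: (Asm (rk x)); apply: (card_le_trans (B := F @` (A `&` [set y | prec y x]))).
    apply: subset_card_le => k _; apply: contrapT => nk.
    by apply: (none k) => y yx Ay Fy; apply: nk; exists y.
  apply: (card_le_trans (card_image_le _ _)); apply: subset_card_le => y [Ay].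
  by move=> [/ltW|[e _]]; split=> //=; rewrite e.
apply: (card_le_inj (f := F)) => // x y Ax Ay Fxy; apply: contrapT => /prect[].
  by move=> /(Fnew _ _ Ax).
by move=> /(Fnew _ _ Ay); rewrite Fxy.
Qed.

Lemma small_card_le T (A : set T) : small A -> A #<= [set: K].
Proof.
move=> sA; have [K0|/set0P[x0 _]] := eqVneq [set: K] set0.
  by exfalso; apply: sA; rewrite K0 card_ge0.
by apply: (card_le_rank (rk := fun=> x0)) => a; apply: sub_small sA => x [].
Qed.

Lemma card_ltE T (A : set T) : card_lt A [set: K] <-> small A.
Proof. by split=> [[]//|sA]; split=> //; exact: small_card_le. Qed.

Lemma ex_least_elt : exists z : K, forall x, z <= x.
Proof.
have [|z _ zmin] := @ex_least [set: K]; last by exists z => x; exact: zmin.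
by apply/set0P/eqP => K0; apply: uncK; rewrite K0; exact: card_ge0.
Qed.

Lemma small_bounded (A : set K) : small A -> exists b, forall x, A x -> x < b.
Proof.
move=> sA; apply: contrapT => nb; apply: sA.
have : A #= [set: K].
  apply: regK => x; apply: contrapT => nx; apply: nb; exists x => y Ay.
  by rewrite ltNge; apply/negP => xy; apply: nx; exists y.
by rewrite card_eq_le => /andP[].
Qed.

Lemma bounded_small (A : set K) b : (forall x, A x -> x < b) -> small A.
Proof. by move=> Ab; apply: sub_small (@small_segment b) => x /Ab. Qed.

(** An injection [f] of [K] into the union gives each [k] an index [i k]. The fibres of [i] are
    small, hence bounded, and their bounds lie below some [c]; then [c], in its own fibre, would be
    below itself. *)
Lemma small_bigcup I T (D : set I) (X : I -> set T) :
  small D -> (forall i, D i -> small (X i)) -> small (\bigcup_(i in D) X i).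
Proof.
move=> sD sX /card_leTP[f [fX fi]].
have /choice[i iP] : forall k, exists i, D i /\ X i (f k).
  by move=> k; have [i] := fX k; exists i.
have /choice[b bP] : forall j, exists b, D j -> forall k, i k = j -> k < b.
  move=> j; have [Dj|nDj] := pselect (D j); last first.
    by have [z _] := ex_least_elt; exists z.
  have [|b bP] := @small_bounded [set k | i k = j]; last by exists b.
  apply: (small_inj (f := f) (B := X j)) (sX _ Dj) => [k <-|]; first by case: (iP k).
  by move=> x y _ _ /fi.
have [c cP] := small_bounded (small_image (f := b) sD).
have Dc := (iP c).1.
have := lt_trans (bP _ Dc c erefl) (cP _ (imageP _ Dc)).
by rewrite ltxx.
Qed.

Lemma countable_small T (A : set T) : countable A -> small A.
Proof. by move=> cA KA; apply: uncK; exact: card_le_trans KA cA. Qed.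

Lemma finite_small T (A : set T) : finite_set A -> small A.
Proof. by move/finite_set_countable/countable_small. Qed.

Lemma small_setU T (A B : set T) : small A -> small B -> small (A `|` B).
Proof.
move=> sA sB; rewrite -bigcup2E; apply: small_bigcup; first exact: countable_small.
by move=> [|[|n]] _ //=; exact: finite_small.
Qed.

(** Splitting by length gives a countable union, which stays small because [K] is uncountable. *)
Lemma small_seqs T (A : set T) : small A -> small [set s : seq T | all (mem A) s].
Proof.
move=> sA; pose L n := [set s : seq T | size s = n /\ all (mem A) s].
apply: (@sub_small _ _ (\bigcup_(n in [set: nat]) L n)).
  by move=> s sP; exists (size s).
apply: small_bigcup => [|n _]; first exact: countable_small.
elim: n => [|n IH].
  by apply: sub_small (finite_small (finite_set1 [::])) => -[]// x s [].
apply: (@sub_small _ _ (\bigcup_(x in A) (cons x @` L n))).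
  move=> [[]//|x s [[sn] /= /andP[/set_mem Ax sA']]]; exists x => //.
  by exists s.
by apply: small_bigcup => // x _; exact: small_image.
Qed.

(* Equivalent to having at most K elements ([rankedP]), but visibly stable under
   products and finite sequences: no prior proof of [K * K #= K] is needed. *)
Definition ranked T := exists rk : T -> K, forall a, small [set x | rk x <= a].

Lemma ranked_card T (A : set T) : ranked T -> A #<= [set: K].
Proof.
by move=> [rk rkP]; apply: (card_le_rank (rk := rk)) => a; apply: sub_small (rkP a) => x [].
Qed.

Lemma rankedP T : ranked T <-> [set: T] #<= [set: K].
Proof.
split=> [|/card_leTP[f [_ fi]]]; first exact: ranked_card.
exists f => a; apply: (small_inj (f := f) (B := [set x | x <= a])) => //.
  by move=> x y _ _ /fi.
rewrite (_ : mkset _ = a |` [set x | x < a]); last first.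
  by apply/seteqP; split=> x /=; rewrite le_eqVlt => /predU1P.
by apply: small_setU; [exact: finite_small|exact: small_segment].
Qed.

Lemma ranked_prod S T : ranked S -> ranked T -> ranked (S * T).
Proof.
move=> [rS sS] [rT sT]; exists (fun p => Order.max (rS p.1) (rT p.2)) => a.
apply: (@sub_small _ _ (\bigcup_(x in [set x | rS x <= a]) (pair x @` [set y | rT y <= a]))).
  by move=> [x y] /=; rewrite ge_max => /andP[xa ya]; exists x => //; exists y.
by apply: small_bigcup => // x _; exact: small_image.
Qed.

Lemma ranked_sum S T : ranked S -> ranked T -> ranked (S + T).
Proof.
move=> [rS sS] [rT sT]; exists (fun p => match p with inl x => rS x | inr y => rT y end) => a.
apply: (@sub_small _ _ (inl @` [set x | rS x <= a] `|` inr @` [set y | rT y <= a])).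
  by move=> [x|y] /= h; [left; exists x|right; exists y].
by apply: small_setU; exact: small_image.
Qed.

Lemma ranked_seq T : ranked T -> ranked (seq T).
Proof.
move=> [rT sT]; have [z zP] := ex_least_elt.
exists (foldr (fun x m => Order.max (rT x) m) z) => a.
apply: sub_small (small_seqs (sT a)) => s /=.
by elim: s => //= x s IH; rewrite ge_max => /andP[xa /IH ->]; rewrite andbT; apply/mem_set.
Qed.

Lemma ranked_K : ranked K.
Proof. by apply/rankedP; exact: card_lexx. Qed.
(** * Filters from weak compactness *)

Section WeaklyCompact.
Hypothesis wcK : weakly_compact K.

Lemma ex_gt (x : K) : exists y, x < y.
Proof.
have [y yP] := small_bounded (finite_small (finite_set1 x)).
by exists y; exact: yP.
Qed.

(* Colour a pair by the lexicographic comparison of the sequences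
   [fun xi => s xi b]; along a homogeneous set these are monotone, and by
   regularity they stabilize coordinate by coordinate. *)
Lemma stabilizing_set (s : K -> K -> bool) :
  exists H : set K, cofinal H /\
    forall xi, exists c e, forall b, H b -> c < b -> s xi b = e.
Proof.
pose lex b b' := exists xi, [/\ forall eta, eta < xi -> s eta b = s eta b',
  s xi b = false & s xi b' = true].
have lex_asym b b' : lex b b' -> lex b' b -> False.
  move=> [x [xP x0 x1]] [y [yP y0 y1]].
  have [xy|yx|xy] := ltgtP x y.
  - by move: (yP _ xy); rewrite x0 x1.
  - by move: (xP _ yx); rewrite y0 y1.
  - by move: x0; rewrite xy y1.
have [_ /(_ (fun b b' => `[< lex b b' >]))[H [e [HK Hhom]]]] := wcK.
have Hcof : cofinal H.
  move=> x; apply: contrapT => nx.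
  have /bounded_small : forall y, H y -> y < x.
    by move=> y Hy; rewrite ltNge; apply/negP => xy; apply: nx; exists y.
  by apply; move: HK; rewrite card_eq_le => /andP[].
exists H; split=> // xi; elim: (lt_wf xi) => {}xi _ IH.
have /choice[c cP] : forall eta, exists c, eta < xi ->
    exists e, forall b, H b -> c < b -> s eta b = e.
  move=> eta; have [/IH[c cP]|] := boolP (eta < xi); first by exists c.
  by exists xi.
have [m mP] := small_bounded (small_image (f := c) (small_segment (a := xi))).
have agree b b' : H b -> H b' -> m < b -> m < b' ->
    forall eta, eta < xi -> s eta b = s eta b'.
  move=> Hb Hb' mb mb' eta ex; have [e' eP] := cP _ ex.
  have cm := mP _ (imageP c ex).
  by rewrite !eP// (lt_trans cm).
(* Beyond [m] the earlier coordinates are constant on [H], so a change at [xi] decides the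
   lexicographic comparison; the colour [e] forbids leaving the value [e]. *)
have mono b b' : H b -> H b' -> m < b -> b < b' -> s xi b = e -> s xi b' = e.
  move=> Hb Hb' mb bb' sb; have Hc := Hhom _ _ Hb Hb' bb'.
  have ag := agree _ _ Hb Hb' mb (lt_trans mb bb').
  case: e Hc sb {Hhom} => [/asboolP Hc|/asboolP Hc] sb.
    apply: contrapT => /negP/negbTE sb'; apply: (lex_asym _ _ Hc).
    by exists xi; split=> // eta /ag.
  by case sb': (s xi b') => //; case: Hc; exists xi; split=> // eta /ag.
have [[b0 [Hb0 mb0 sb0]]|none] := pselect (exists b, [/\ H b, m < b & s xi b = e]).
  by exists b0, e => b Hb b0b; exact: (mono b0).
exists m, (~~ e) => b Hb mb.
have : s xi b <> e by move=> sb; apply: none; exists b.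
by case: (s xi b); case: (e).
Qed.

Lemma stabilizing_set_ranked J (s : J -> K -> bool) : ranked J ->
  exists H : set K, cofinal H /\
    forall j, exists c e, forall b, H b -> c < b -> s j b = e.
Proof.
move=> /(rankedP)/card_leTP[f [_ fi]].
have [H [Hcof HP]] := stabilizing_set (fun xi b => `[< exists j, f j = xi /\ s j b >]).
exists H; split=> // j; have [c [e ceP]] := HP (f j).
exists c, e => b Hb cb; rewrite -(ceP _ Hb cb).
by apply/idP/asboolP => [sb|[j' [/fi ->]]//]; exists j.
Qed.

Definition complete_filter (E : set (set K)) : Prop :=
  [/\ forall X Y : set K, X `<=` Y -> E X -> E Y,
      forall X : set K, E X -> X !=set0,
      forall T (D : set T) (X : T -> set K), small D ->
        (forall t, D t -> E (X t)) -> E (\bigcap_(t in D) X t) &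
      forall c, E [set a | c < a]].

(* [E] is the image of the tail filter of a stabilizing set under a function
   [iter_word w], where [w] is minimal among the words whose function is
   unbounded: this minimality is what replaces normality. *)
Lemma normal_filter I J (r : I -> K -> K) (phi : J -> K -> bool) :
  ranked I -> ranked J ->
  exists E : set (set K), [/\ complete_filter E,
    forall j, exists e, E [set a | phi j a = e] &
    forall i, E [set a | r i a < a] -> exists c, E [set a | r i a < c]].
Proof.
move=> rkI rkJ.
pose word w b := foldr r b w.
(* Stabilizing these predicates decides which bounds [v] a word eventually respects and which value
   [phi j] takes along it. *)
pose psi (x : seq I * K + seq I * J) b :=
  match x with inl (w, v) => word w b < v | inr (w, j) => phi j (word w b) end.
have [|H [Hcof HP]] := @stabilizing_set_ranked _ psi.
  have rkw := ranked_seq rkI.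
  by apply: ranked_sum => //; apply: ranked_prod => //; exact: ranked_K.
pose Ev (X : set K) := exists c, forall b, H b -> c < b -> X b.
pose unb w := forall c, Ev [set b | c <= word w b].
have unb0 : unb [::] by move=> c; exists c => b _ /ltW.
have unbN w : ~ unb w -> exists c, Ev [set b | word w b < c].
  move=> /existsNP[v nv]; exists v; have [c [[] ceP]] := HP (inl (w, v)).
    by exists c => b Hb cb; exact: ceP.
  by case: nv; exists c => b Hb cb; rewrite /= leNgt; have /= -> := ceP _ Hb cb.
have [w [unbw wmin]] : exists w, unb w /\
    forall i, unb (i :: w) -> ~ Ev [set b | word (i :: w) b < word w b].
  (* Otherwise, at a point [b] of [H] beyond countably many thresholds, the values [word (W n) b]
     would descend forever in [K]. *)
  apply: contrapT => nmin.
  have /choice[st stP] : forall w, exists w', unb w ->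
      unb w' /\ Ev [set b | word w' b < word w b].
    move=> w; have [uw|nu] := pselect (unb w); last by exists w.
    apply: contrapT => nw; apply: nmin; exists w; split=> // i ui Evi.
    by apply: nw; exists (i :: w).
  pose W n := iter n st [::].
  have unbW n : unb (W n) by elim: n => // n /stP[].
  have /choice[c cP] n := (stP _ (unbW n)).2.
  have [m mP] := small_bounded (small_image (f := c) (countable_small (countableP [set: nat]))).
  have [b Hb mb] := Hcof m.
  have [|_ [n _ <-] nmin'] := ex_least (A := range (fun n => word (W n) b)).
    by exists (word (W 0%N) b); exists 0%N.
  have /nmin' : range (fun n => word (W n) b) (word (W n.+1) b) by exists n.+1.
  rewrite leNgt => /negP; apply; apply: cP => //.
  by apply: lt_le_trans mb; apply: mP; exists n.
exists [set X : set K | Ev [set b | X (word w b)]]; split.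
- split.
  + by move=> X Y XY [c cP]; exists c => b Hb /(cP _ Hb)/XY.
  + move=> X [c cP]; have [c' cc'] := ex_gt c; have [b Hb c'b] := Hcof c'.
    by exists (word w b); apply: cP => //; exact: lt_le_trans c'b.
  + move=> T D X sD EX.
    have /choice[c cP] : forall t, exists c, D t -> forall b, H b -> c < b -> X t (word w b).
      move=> t; have [/EX[c cP]|nDt] := pselect (D t); first by exists c.
      by have [z _] := ex_least_elt; exists z.
    have [m mP] := small_bounded (small_image (f := c) sD).
    by exists m => b Hb mb t Dt; apply: cP => //; apply: lt_trans mb; apply: mP; exists t.
  + move=> c; have [c' cc'] := ex_gt c; have [m mP] := unbw c'.
    by exists m => b Hb mb; apply: lt_le_trans cc' _; exact: mP.
- by move=> j; have [c [e ceP]] := HP (inr (w, j)); exists e, c.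
- by move=> i Ei; apply: (unbN (i :: w)) => /wmin; exact.
Qed.

Lemma complete_filterI (E : set (set K)) (X Y : set K) :
  complete_filter E -> E X -> E Y -> E (X `&` Y).
Proof.
move=> [Emono _ Ecap _] EX EY;
  apply: (Emono (\bigcap_(t in [set: bool]) if t then X else Y)).
  by move=> a XYa; split; [exact: (XYa true)|exact: (XYa false)].
by apply: Ecap => [|[] _ //]; exact: finite_small.
Qed.

(** * Layering *)

Section Layering.
Context {d' : Order.disp_t} (P : porderType d').

(** Some [A] is a maximal antichain in [X] but not in [P], so some [p] outside [A] is incompatible
    with all of [A]. A reduct [q] of [p] would be incompatible with all of [A] too, hence in [A] by
    maximality, yet it is compatible with itself. *)
Lemma ex_no_reduct (X : set P) :
  (forall p q, X p -> X q -> compatible [set: P] p q -> compatible X p q) ->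
  ~ regular_suborder X ->
  exists p, forall q, X q -> exists r, [/\ X r, r <= q & ~ compatible [set: P] r p].
Proof.
move=> Xcompat nreg.
have [A [[[AX Aanti] Amax] nA]] : exists A,
    maximal_antichain X A /\ ~ maximal_antichain [set: P] A.
  apply: contrapT => nA; apply: nreg; split.
    by move=> p q Xp Xq; apply: contra_not; exact: Xcompat.
  by move=> A Amax; apply: contrapT => nAmax; apply: nA; exists A.
have AantiT : antichain [set: P] A.
  split=> // p q Ap Aq pq /(Xcompat _ _ (AX _ Ap) (AX _ Aq)); exact: Aanti.
have [p [B [Banti AB Bp nAp]]] : exists p B,
    [/\ antichain [set: P] B, A `<=` B, B p & ~ A p].
  apply: contrapT => np; apply: nA; split=> // B Banti AB.
  apply/seteqP; split=> // p Bp; apply: contrapT => nAp.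
  by apply: np; exists p, B.
exists p => q Xq; apply: contrapT => nr.
have qA a : A a -> ~ compatible X q a.
  move=> Aa [r [Xr rq ra]]; apply: nr; exists r; split=> // -[s [_ sr sp]].
  apply: (Banti.2 a p (AB _ Aa) Bp); first by move=> ap; apply: nAp; rewrite -ap.
  by exists s; split=> //; exact: le_trans ra.
have Aq : A q.
  rewrite -(Amax (q |` A)); [by left| |by move=> x Ax; right].
  split=> [x [->//|/AX//]|x y [->|Ax] [->|Ay]//].
  - by move=> _; exact: qA.
  - by move=> _ /compatible_sym; exact: qA.
  - exact: Aanti.
by apply: (qA q Aq); exists q.
Qed.

(** Cofinality lets [Y] absorb [X], a lower bound for each compatible pair and one point without
    reduct. The last clause is conditional because [ex_no_reduct] needs an [X] that already contains
    witnesses of compatibility. *)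
Lemma layered_step (C : set (set P)) :
  cofinal_in_Pkappa K C -> (forall X, C X -> ~ regular_suborder X) ->
  forall X, small X -> exists Y, [/\ C Y, X `<=` Y,
    forall p q, X p -> X q -> compatible [set: P] p q -> compatible Y p q &
    C X -> (forall p q, X p -> X q -> compatible [set: P] p q -> compatible X p q) ->
    exists2 p, Y p &
      forall q, X q -> exists r, [/\ X r, r <= q & ~ compatible [set: P] r p]].
Proof.
move=> Ccof nreg X sX.
have /choice[w wP] : forall pq : P * P, exists r, compatible [set: P] pq.1 pq.2 ->
    r <= pq.1 /\ r <= pq.2.
  move=> [p q]; have [[r [_ rp rq]]|n] := pselect (compatible [set: P] p q); first by exists r.
  by exists p.
have [S [finS SP]] : exists S : set P, finite_set S /\ (C X ->
    (forall p q, X p -> X q -> compatible [set: P] p q -> compatible X p q) ->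
    exists2 p, S p &
      forall q, X q -> exists r, [/\ X r, r <= q & ~ compatible [set: P] r p]).
  have [[CX /ex_no_reduct[]]|n] := pselect (C X /\
      forall p q, X p -> X q -> compatible [set: P] p q -> compatible X p q).
  - exact: nreg.
  - by move=> p pP; exists [set p]; split=> //; exists p.
  - by exists set0; split=> // CX h; case: n.
have [|Y CY XY] := Ccof (X `|` (\bigcup_(p in X) ((fun q => w (p, q)) @` X) `|` S)).
  apply/card_ltE; apply: small_setU => //; apply: small_setU; last exact: finite_small.
  by apply: small_bigcup => // p _; exact: small_image.
exists Y; split=> //.
- by move=> p Xp; apply: XY; left.
- move=> p q Xp Xq pq; have [wp wq] := wP (p, q) pq.
  by exists (w (p, q)); split=> //; apply: XY; right; left; exists p => //; exists q.
- by move=> CX /(SP CX)[p Sp pP]; exists p => //; apply: XY; right; right.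
Qed.

Theorem weakly_compact_layered : chain_condition K P -> stationarily_layered K P.
Proof.
move=> ccP C [CP Ccof Cchain]; apply/set0P/negP => /eqP noreg.
have nreg X : C X -> ~ regular_suborder X.
  move=> CX Xreg; have : set0 X by rewrite -noreg; split=> //; split=> //; exact: CP.
  by [].
have /choice[G GP] : forall X, exists Y, small X -> [/\ C Y, X `<=` Y,
    forall p q, X p -> X q -> compatible [set: P] p q -> compatible Y p q &
    C X -> (forall p q, X p -> X q -> compatible [set: P] p q -> compatible X p q) ->
    exists2 p, Y p &
      forall q, X q -> exists r, [/\ X r, r <= q & ~ compatible [set: P] r p]].
  move=> X; have [/(layered_step Ccof nreg)[Y YP]|nX] := pselect (small X); first by exists Y.
  by exists X.
pose Q := Fix lt_wf (fun=> set P)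
  (fun a rec => [set p | exists b (h : b < a), G (rec b h) p]).
have QE a : Q a = \bigcup_(b in [set b | b < a]) G (Q b).
  rewrite /Q Fix_eq => [|{}a f g fg].
    by apply/seteqP; split=> p [b]; [move=> [h Gp]; exists b|move=> h Gp; exists b, h].
  by apply/seteqP; split=> p [b [h Gp]]; exists b, h; move: Gp; rewrite fg.
have [z zmin] := ex_least_elt.
have Qsmall a : small (Q a).
  elim: (lt_wf a) => {}a _ IH; rewrite QE; apply: small_bigcup; first exact: small_segment.
  by move=> b ba; have [/CP/card_ltE] := GP _ (IH _ ba).
have GQ b a : b < a -> G (Q b) `<=` Q a.
  by move=> ba; rewrite (QE a) => p Gp; exists b.
have QG a : Q a `<=` G (Q a) by have [] := GP _ (Qsmall a).
have Gmono b a : b <= a -> G (Q b) `<=` G (Q a).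
  rewrite le_eqVlt => /predU1P[->//|/GQ ba]; exact: subset_trans (QG a).
(* The stage [Q z] is an empty union, which chain closure does not put into [C]. *)
have QC a : z < a -> C (Q a).
  move=> za; rewrite QE; apply: Cchain => [|i ia|i j ij ja].
  - by exists z.
  - by have [] := GP _ (Qsmall i).
  - exact: Gmono.
pose bad a := exists p q,
  [/\ Q a p, Q a q, compatible [set: P] p q & ~ compatible (Q a) p q].
have nbad a : ~ bad a ->
    forall p q, Q a p -> Q a q -> compatible [set: P] p q -> compatible (Q a) p q.
  by move=> nb p q Qp Qq pq; apply: contrapT => npq; apply: nb; exists p, q.
(* A default value for the choices below. *)
have [p0 _] : exists p : P, True.
  apply: contrapT => nP; have [a za] := ex_gt z.
  have [|p _] := ex_no_reduct _ (nreg _ (QC _ za)); last by apply: nP; exists p.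
  by move=> p; case: nP; exists p.
(* A bad [a] is a successor: the offending [p] and [q] enter after stages [b1] and [b2], and any
   stage strictly between both of these and [a] would add a common extension. So [pd a] is the
   immediate predecessor of [a]. *)
have /choice[pd pdP] : forall a, exists b, z < a ->
    b < a /\ (bad a -> forall c, c < a -> c <= b).
  move=> a; have [[p [q [Qp Qq pq npq]]]|nb] := pselect (bad a); last by exists z.
  move: Qp Qq; rewrite QE => -[b1 b1a G1] [b2 b2a G2].
  exists (Order.max b1 b2) => _; split=> [|_ c ca]; first by rewrite gt_max b1a b2a.
  rewrite leNgt; apply/negP; rewrite gt_max => /andP[b1c b2c]; apply: npq.
  have [_ _ /(_ p q) H _] := GP _ (Qsmall c).
  have [r [Gr rp rq]] := H (GQ _ _ b1c _ G1) (GQ _ _ b2c _ G2) pq.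
  by exists r; split=> //; exact: (GQ _ _ ca).
pose Qk := \bigcup_a G (Q a).
have QQk a : Q a `<=` Qk by move=> p /QG Gp; exists a.
have /choice[po poP] : forall a, exists p, z < a -> ~ bad a -> Qk p /\
    forall q, Q a q -> exists r, [/\ Q a r, r <= q & ~ compatible [set: P] r p].
  move=> a; have [[za nb]|n] := pselect (z < a /\ ~ bad a); last first.
    by exists p0 => za nb; case: n.
  have [_ _ _ H] := GP _ (Qsmall a); have [p Gp pP] := H (QC _ za) (nbad _ nb).
  by exists p => _ _; split=> //; exists a.
have /choice[h hP] : forall aq : K * P, exists r, z < aq.1 -> ~ bad aq.1 -> Q aq.1 aq.2 ->
    [/\ Q aq.1 r, r <= aq.2 & ~ compatible [set: P] r (po aq.1)].
  move=> [a q] /=; have [[za nb Qq]|n] := pselect [/\ z < a, ~ bad a & Q a q]; last first.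
    by exists p0 => za nb Qq; case: n.
  by have [_ /(_ _ Qq)[r rP]] := poP _ za nb; exists r.
have /choice[rk rkP] : forall p, exists b, Qk p ->
    G (Q b) p /\ forall c, G (Q c) p -> b <= c.
  move=> p; have [[b _ Gb]|n] := pselect (Qk p); last by exists z.
  by have [|c Gc cmin] := @ex_least [set c | G (Q c) p]; [exists b|exists c].
have rk_lt a p : Q a p -> rk p < a.
  move=> Qp; have [_ rmin] := rkP p (QQk _ _ Qp).
  by move: Qp; rewrite QE => -[b ba /rmin rb]; exact: le_lt_trans ba.
have lt_rk a p : Qk p -> rk p < a -> Q a p.
  by move=> /rkP[Gp _] ra; exact: GQ ra _ Gp.
have Qkranked : ranked (set_type Qk).
  apply/rankedP; apply: (card_le_rank (rk := fun p : set_type Qk => rk (val p))) => a.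
  have [b ab] := ex_gt a.
  apply: (small_inj (f := val) (B := Q b)) => [p [_ /= pa]|x y _ _ /val_inj//|].
    by apply: lt_rk; [exact: set_valP|exact: le_lt_trans ab].
  exact: Qsmall.
have unitranked : ranked unit by exists (fun=> z) => a; exact: finite_small.
(* The filter handles functions into [K], so [h] enters through the rank of its value; the
   predicates then identify the value itself. The [unit] index carries [pd]. *)
have [E [Efilt Ephi Enorm]] := normal_filter
  (fun (i : unit + set_type Qk) a => if i is inr q then rk (h (a, val q)) else pd a)
  (fun (j : set_type Qk * set_type Qk) a => `[< h (a, val j.1) = val j.2 >])
  (ranked_sum unitranked Qkranked) (ranked_prod Qkranked Qkranked).
have [Emono Ene Ecap Etail] := Efilt.
have EI := @complete_filterI _ _ _ Efilt.
have Egood : E [set a | z < a /\ ~ bad a].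
  (* As [pd] is regressive, it is bounded by some [c] on a set in [E]; a bad [a] above [c] would
     give [c <= pd a < c]. *)
  have [|c Ec] := Enorm (inl tt).
    by apply: (Emono _ _ _ (Etail z)) => a /= za; have [] := pdP _ za.
  apply: (Emono _ _ _ (EI _ _ (EI _ _ Ec (Etail c)) (Etail z))) => a [[/= pc ca] za].
  split=> // ba; have [_ /(_ ba _ ca)] := pdP _ za.
  by rewrite leNgt pc.
have Qkdense q : Qk q ->
    exists r, [/\ Qk r, r <= q & E [set a | ~ compatible [set: P] r (po a)]].
  move=> Qkq; pose q' : set_type Qk := exist _ q (mem_set Qkq).
  have Eh : E [set a | [/\ Q a (h (a, q)), h (a, q) <= q &
      ~ compatible [set: P] (h (a, q)) (po a)]].
    apply: (Emono _ _ _ (EI _ _ Egood (Etail (rk q)))) => a [[za nb] /= ra].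
    by apply: hP => //=; exact: lt_rk.
  have [|c Ec] := Enorm (inr q').
    by apply: (Emono _ _ _ Eh) => a [/rk_lt].
  (* Values of rank below [c] lie in the small set [Q c]. If each were avoided on a set in [E],
     completeness would avoid all of them at once. *)
  have [r Qr Er] : exists2 r, Q c r & E [set a | h (a, q) = r].
    apply: contrapT => nr.
    have En r : Q c r -> E [set a | h (a, q) <> r].
      move=> Qr; have [[] Ee] := Ephi (q', exist _ r (mem_set (QQk _ _ Qr))).
        case: nr; exists r => //; apply: (Emono _ _ _ Ee) => a /=.
        by move/asboolP.
      by apply: (Emono _ _ _ Ee) => a /= /asboolP.
    have /Ene[a [[[Qh _ _] /= rc] nh]] := EI _ _ (EI _ _ Eh Ec) (Ecap _ _ _ (Qsmall c) En).
    by apply: (nh (h (a, q))) => //; apply: lt_rk rc; exact: QQk Qh.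
  have /Ene[a [[_ hq _] /= hr]] := EI _ _ Eh Er.
  exists r; split; [exact: QQk Qr|by rewrite -hr|].
  by apply: (Emono _ _ _ (EI _ _ Eh Er)) => b [[_ _ +] /= hbr]; rewrite hbr.
have [|A [AD Aind Amax]] := @maximal_independent _ (compatible [set: P])
    [set r | Qk r /\ E [set a | ~ compatible [set: P] r (po a)]].
  by move=> x y; exact: compatible_sym.
have /card_ltE sA : card_lt A [set: K] by apply: ccP; split.
have EA := Ecap _ _ (fun r => [set a | ~ compatible [set: P] r (po a)]) sA
  (fun r Ar => (AD r Ar).2).
have /Ene[a [[za nb] incA]] := EI _ _ Egood EA.
have [Qkp _] := poP _ za nb.
(* Density below [po a] itself gives an [r] in the set in which [A] is maximal. *)
have [r [Qkr rp Er]] := Qkdense _ Qkp.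
have [Ar|[t At [s [_ sr st]]]] := Amax r (conj Qkr Er).
  by apply: (incA r Ar); exists r.
by apply: (incA t At); exists s; split=> //; exact: le_trans rp.
Qed.

End Layering.

End WeaklyCompact.

(** * The chain condition for finite independent sets *)

Lemma small_subsingleton T (A : set T) : (forall x y, A x -> A y -> x = y) -> small A.
Proof.
move=> A1; have [->|/set0P[x Ax]] := eqVneq A set0; first exact: finite_small.
by apply: (@sub_small _ _ [set x]) => [y Ay|]; [exact: A1|exact: finite_small].
Qed.

Lemma filter_all (T : Type) (S : eqType) (F : set_system T) (s : seq S) (Y : S -> set T) :
  Filter F -> (forall x, x \in s -> F (Y x)) -> F [set t | forall x, x \in s -> Y x t].
Proof.
move=> FF; elim: s => [|x s IH] FY; first by apply: filterS filterT => t.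
have Fs : F [set t | forall y, y \in s -> Y y t].
  by apply: IH => y ys; apply: FY; rewrite in_cons ys orbT.
apply: filterS (filterI (FY x (mem_head _ _)) Fs) => t [Yx Ys] y.
by rewrite in_cons => /predU1P[->//|/Ys].
Qed.

(* Baumgartner's argument: thin out to a Delta-system of [n]-element sets with
   root [S], and take an ultrafilter [U] of co-small sets on it. For each [j]
   the points below [U]-almost all [j]-th elements form a chain, so all these
   points together are few; yet every member has such a point outside [S]. *)
Lemma finindep_chain_condition (T : choiceType) (R : T -> T -> Prop) :
  (forall x, small [set y | R y x]) ->
  (forall x y z, R x z -> R y z -> [\/ x = y, R x y | R y x]) ->
  (forall B : set T, (forall x y, B x -> B y -> [\/ x = y, R x y | R y x]) -> small B) ->
  chain_condition K (finindep R).
Proof.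
move=> sR treeR chainR W [_ Wanti]; apply/card_ltE; apply: contrapT => nsW.
have [n nsWn] : exists n, ~ small (W `&` [set p | #|` val p| = n]).
  apply: contrapT => nn; apply: nsW.
  apply: (@sub_small _ _ (\bigcup_n (W `&` [set p | #|` val p| = n]))).
    by move=> p Wp; exists #|` val p|.
  apply: small_bigcup => [|n _]; first exact: countable_small.
  by apply: contrapT => nsn; apply: nn; exists n.
pose V S := W `&` [set p | #|` val p| = n] `&` [set p | (S `<=` val p)%fset].
have [S [nsV Smax]] : exists S, ~ small (V S) /\
    forall x, x \notin S -> small (V (x |` S)%fset).
  (* Otherwise roots could be enlarged forever, but [V S] is empty once [S] has more than [n]
     elements. *)
  apply: contrapT => nS.
  have big m : exists S : {fset T}, #|` S| = m /\ ~ small (V S).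
    elim: m => [|m [S [Sm nsV]]].
      exists fset0; split=> //; apply: contra_not nsWn; apply: sub_small.
      by move=> p Wp; split=> //; exact: fsub0set.
    apply: contrapT => nx; apply: nS; exists S; split=> // x xS.
    apply: contrapT => nsx; apply: nx; exists (x |` S)%fset.
    by rewrite cardfsU1 xS Sm.
  have [S [Sn nsV]] := big n.+1.
  apply: nsV; rewrite (_ : V S = set0); first exact: finite_small.
  apply/seteqP; split=> // p [[_ /= pn] /fsubset_leq_card].
  by rewrite Sn pn ltnn.
have [|M [MV Mind Mmax]] := @maximal_independent _
    (fun p q : finindep R => exists x, [/\ x \notin S, x \in val p & x \in val q]) (V S).
  by move=> p q [x [? ? ?]]; exists x.
have MS p x : M p -> x \in S -> x \in val p by move=> /MV[_ /fsubsetP]; exact.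
have M1 x : x \notin S -> small (M `&` [set p | x \in val p]).
  move=> xS; apply: small_subsingleton => p q [Mp xp] [Mq xq].
  by apply: contrapT => pq; apply: (Mind _ _ Mp Mq pq); exists x.
(* Were [M] small, each member of [V S] outside [M] would contain one of few points outside [S], and
   each such point lies in few members. *)
have nsM : ~ small M.
  move=> sM; apply: nsV.
  pose D := (\bigcup_(p in M) [set` val p]) `\` [set` S].
  apply: (@sub_small _ _ (M `|` \bigcup_(x in D) V (x |` S)%fset)).
    move=> p Vp; have [Mp|[q Mq [x [xS xp xq]]]] := Mmax p Vp; [by left|right].
    exists x; first by split; [exists q|exact/negP].
    by case: Vp => Wp Sp; split=> //=; rewrite fsubUset fsub1set xp.
  apply: small_setU => //; apply: small_bigcup => [|x [_ /negP/Smax]//].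
  apply: (@sub_small _ _ (\bigcup_(p in M) [set` val p])); first by move=> x [].
  by apply: small_bigcup => // p _; apply: finite_small; exact: finite_fset.
pose F : set_system (finindep R) := [set X | small (M `\` X)].
have PF : ProperFilter F.
  apply: Build_ProperFilter.
    by rewrite /F /= setD0.
  split.
  - by rewrite /F /= setDT; exact: finite_small.
  - by move=> X Y FX FY; rewrite /F /= setDIr; exact: small_setU.
  - by move=> X Y XY; apply: sub_small => p [Mp nY]; split=> // /XY.
have [U [UU FU]] := ultraFilterLemma PF.
pose Y (xj : T * nat) := [set p : finindep R |
  (xj.2 < #|` val p|)%N /\ R xj.1 (nth xj.1 (val p) xj.2)].
pose B := \bigcup_(j in [set: nat]) [set x | U (Y (x, j))].
have sB : small B.
  apply: small_bigcup => [|j _]; first exact: countable_small.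
  apply: chainR => x y Ux Uy;
  have /filter_ex[p [[/= jp Rx] [_ /= Ry]]] : U (Y (x, j) `&` Y (y, j)) by exact: filterI.
  by apply: (treeR _ _ _ Rx); rewrite (set_nth_default y).
have MB p : M p -> exists x, [/\ x \notin S, x \in val p & B x].
  move=> Mp; apply: contrapT => nB.
  (* For almost every [q] in [M], no point of [q] outside [S] is below a point of [p], since few [q]
     fail by disjointness; and none is above a point of [p] outside [S], since finitely many sets
     [Y] are avoided. Such a [q] is compatible with [p]. *)
  have Up : U [set q | [/\ M q, q <> p &
      forall y, y \in val q -> y \notin S -> forall x, x \in val p -> ~ R y x]].
    apply: FU; apply: (@sub_small _ _ ([set p] `|`
      \bigcup_(x in [set` val p]) \bigcup_(y in [set y | R y x] `\` [set` S])
        (M `&` [set q | y \in val q]))).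
      move=> q [Mq nq]; have [->|qp] := pselect (q = p); [by left|right].
      apply: contrapT => nxy; apply: nq; split=> // y yq yS x xp Ryx; apply: nxy.
      by exists x => //; exists y => //; split=> //; exact/negP.
    apply: small_setU; first exact: finite_small.
    apply: small_bigcup => [|x _]; first by apply: finite_small; exact: finite_fset.
    apply: small_bigcup => [|y [_ /negP]]; last exact: M1.
    by apply: sub_small (sR x) => y [].
  have UY : U [set q | forall xj,
      xj \in [seq (x, j) | x <- [seq x <- val p | x \notin S], j <- iota 0 n] -> ~ Y xj q].
    apply: filter_all => xj /allpairsP[[x j] /= [+ _ ->]].
    rewrite mem_filter => /andP[xS xp].
    have [UY|//] := in_ultra_setVsetC (Y (x, j)) UU.
    by case: nB; exists x; split=> //; exists j.
  have [q [[Mq qp Rqp] nY]] := filter_ex (filterI Up UY).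
  have [[[Wp _] _] [[Wq qn] _]] := (MV _ Mp, MV _ Mq).
  apply: (Wanti _ _ Wp Wq); first by move=> pq; apply: qp.
  apply: finindep_compatible => x y xp yq.
  have [xS|xS] := boolP (x \in S).
    by split; apply: (@finindepP _ _ q) => //; exact: MS xS.
  have [yS|yS] := boolP (y \in S).
    by split; apply: (@finindepP _ _ p) => //; exact: MS yS.
  split=> [Rxy|]; last exact: Rqp.
  have yn : (index y (val q) < n)%N by rewrite -qn index_mem.
  apply: (nY (x, index y (val q))).
    by apply/allpairsP; exists (x, index y (val q)); rewrite mem_filter xS xp mem_iota.
  by split; rewrite /= ?qn// nth_index.
apply: nsM.
apply: (@sub_small _ _ (\bigcup_(x in B `\` [set` S]) (M `&` [set p | x \in val p]))).
  by move=> p Mp; have [x [xS xp Bx]] := MB _ Mp; exists x => //; split=> //; exact/negP.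
apply: small_bigcup => [|x [_ /negP]]; last exact: M1.
by apply: sub_small sB => x [].
Qed.

(** Without a reduct, the elements of [Q] incompatible with [p] are dense in [Q]. A maximal
    antichain of such elements is maximal in [Q], hence in [P], although [p] is incompatible with
    all of it. *)
Lemma regular_suborder_reduct {d' : Order.disp_t} (P : porderType d') (Q : set P) (p : P) :
  regular_suborder Q ->
  exists2 q, Q q & forall r, Q r -> r <= q -> compatible [set: P] r p.
Proof.
move=> [_ Qmax]; apply: contrapT => nq.
have dense q : Q q -> exists r, [/\ Q r, r <= q & ~ compatible [set: P] r p].
  move=> Qq; apply: contrapT => nr; apply: nq; exists q => // r Qr rq.
  by apply: contrapT => nrp; apply: nr; exists r.
have [|A [AD Aind Amax]] := @maximal_independent _ (compatible Q)
    [set r | Q r /\ ~ compatible [set: P] r p].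
  by move=> x y; exact: compatible_sym.
have /Qmax[[_ Aanti] AmaxP] : maximal_antichain Q A.
  split; first by split=> // x /AD[].
  move=> B [BQ Banti] AB; apply/seteqP; split=> // b Bb; apply: contrapT => nAb.
  have [r [Qr rb nrp]] := dense b (BQ _ Bb).
  have [a [Aa [s [Qs sr sa]]]] : exists a, A a /\ compatible Q r a.
    by have [Ar|[a Aa ra]] := Amax r (conj Qr nrp); [exists r; split=> //; exists r|exists a].
  apply: (Banti a b (AB _ Aa) Bb); first by move=> ab; apply: nAb; rewrite -ab.
  by exists s; split=> //; exact: le_trans rb.
have Ap : A p.
  rewrite -(AmaxP (p |` A)); [by left| |by move=> x Ax; right].
  split=> // x y [->|Ax] [->|Ay] xy //.
  - by move=> /compatible_sym; exact: (AD _ Ay).2.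
  - exact: (AD _ Ax).2.
  - exact: Aanti.
by apply: (AD _ Ap).2; exists p.
Qed.

(** * The Erdos-Rado tree *)

Section EndHomogeneousTree.
Variable f : K -> K -> bool.

(* Along a chain of this tree, [f k i] depends on [k] only. *)
Definition below : K -> K -> Prop :=
  Fix lt_wf (fun=> K -> Prop)
    (fun i rec j => i < j /\ forall k (h : k < i), rec k h i -> f k i = f k j).

Lemma belowE i j : below i j <-> i < j /\ forall k, below k i -> f k i = f k j.
Proof.
have E k l : below k l = (k < l /\ forall m (h : m < k), below m k -> f m k = f m l).
  rewrite {1}/below Fix_eq // => {}k g h gh; apply/funext => m; apply/propext.
  by split=> -[km H]; split=> // x xk; have := H x xk; rewrite gh.
rewrite E; split=> -[ij H]; split=> // k.
  by move=> ki; apply: H => //; move: ki; rewrite E => -[].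
by move=> _; exact: H.
Qed.

Lemma below_lt i j : below i j -> i < j.
Proof. by move=> /belowE[]. Qed.

Lemma below_f k i j : below k i -> below i j -> f k i = f k j.
Proof. by move=> ki /belowE[_]; exact. Qed.

Lemma below_irr i : ~ below i i.
Proof. by move=> /below_lt; rewrite ltxx. Qed.

Lemma below_small i : small [set y | below y i].
Proof. by apply: (@bounded_small _ i) => y /below_lt. Qed.

Lemma below_trans i j k : below i j -> below j k -> below i k.
Proof.
elim: (lt_wf i) j k => {}i _ IH j k ij jk; apply/belowE; split.
  exact: lt_trans (below_lt ij) (below_lt jk).
move=> l li; rewrite (below_f li ij); apply: below_f jk.
exact: IH (below_lt li) _ _ li ij.
Qed.

Lemma below_comparable_lt i j k : below i k -> below j k -> i < j -> below i j.
Proof.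
elim: (lt_wf i) => {}i _ IH ik jk ij; apply/belowE; split=> // l li.
rewrite (below_f li ik); apply/esym/below_f/jk.
have lk := below_trans li ik.
by apply: IH => //; [exact: below_lt|exact: lt_trans (below_lt li) ij].
Qed.

Lemma below_comparable i j k :
  below i k -> below j k -> [\/ i = j, below i j | below j i].
Proof.
move=> ik jk; have [ij|ji|->] := ltgtP i j; last by constructor 1.
  by constructor 2; exact: below_comparable_lt jk ij.
by constructor 3; exact: below_comparable_lt ik ji.
Qed.

(** On a chain, [f x y] with [x < y] depends on [x] only, so the chain is covered by two homogeneous
    sets, one for each colour. *)
Lemma below_chain_small (B : set K) :
  ~ (exists (H : set K) (b : bool), H #= [set: K] /\
      forall x y, H x -> H y -> x < y -> f x y = b) ->
  (forall x y, B x -> B y -> [\/ x = y, below x y | below y x]) -> small B.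
Proof.
move=> nohom Bchain.
have Blt x y : B x -> B y -> x < y -> below x y.
  move=> Bx By xy; have [xy'|//|/below_lt yx] := Bchain _ _ Bx By.
    by rewrite xy' ltxx in xy.
  by have := lt_trans xy yx; rewrite ltxx.
pose H b := B `&` [set x | forall y, B y -> x < y -> f x y = b].
have sH b : small (H b).
  move=> KH; apply: nohom; exists (H b), b; split.
    by rewrite card_eq_le card_leT.
  by move=> x y [_ Hx] [By _]; exact: Hx.
apply: (@sub_small _ _ (H true `|` H false)); last exact: small_setU.
move=> x Bx; have [[y [By xy fxy]]|n] := pselect (exists y, [/\ B y, x < y & f x y = false]).
  right; split=> // y' By' xy'; rewrite -fxy.
  have [->//|yy|yy] := Bchain _ _ By By'.
    by apply/esym/(below_f _ yy)/Blt.
  by apply: (below_f _ yy); exact: Blt.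
left; split=> // y By xy; apply: contrapT => /negP/negbTE fxy.
by apply: n; exists y.
Qed.

(** When there is one, [u k e] is the immediate successor of [k] in the tree in direction [e]. *)
Lemma ex_next : exists u : K -> bool -> K, forall k e,
  (exists l, below k l /\ f k l = e) ->
  [/\ below k (u k e), f k (u k e) = e & forall l, below k l -> f k l = e -> u k e <= l].
Proof.
have /choice[u uP] : forall ke : K * bool, exists v,
    (exists l, below ke.1 l /\ f ke.1 l = ke.2) ->
    [/\ below ke.1 v, f ke.1 v = ke.2 &
      forall l, below ke.1 l -> f ke.1 l = ke.2 -> v <= l].
  move=> [k e] /=; have [ex|n] := pselect (exists l, below k l /\ f k l = e).
    have [v [kv fv] vmin] := ex_least (A := [set l | below k l /\ f k l = e]) ex.
    by exists v => _; split=> // l kl fl; exact: vmin.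
  by exists k.
by exists (fun k e => u (k, e)) => k e; exact: (uP (k, e)).
Qed.

(** * Sets of nodes closed under predecessors and immediate successors *)

Section Closed.
Variables (u : K -> bool -> K) (z : K).
Hypothesis uP : forall k e, (exists l, below k l /\ f k l = e) ->
  [/\ below k (u k e), f k (u k e) = e & forall l, below k l -> f k l = e -> u k e <= l].
Hypothesis zmin : forall x, z <= x.

Definition tree_closed (M : set K) : Prop :=
  [/\ forall x y, M y -> below x y -> M x, forall x e, M x -> M (u x e) & M z].

(* Otherwise let [v] be the least node up to [t] outside [M]. Its predecessors
   lie in [M], hence below [x], and there is no last one among them; so [x] and
   [v] agree on all of them, which makes [x] and [v] comparable. *)
Lemma tree_closed_split (M : set K) x t : tree_closed M -> M x -> ~ M t -> ~ below x t ->
  exists s, [/\ M s, below s t & ~ below s x].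
Proof.
move=> [Mdown Mnext _] Mx nMt nxt; apply: contrapT => ns.
have Lx s : M s -> below s t -> below s x.
  by move=> Ms st; apply: contrapT => nsx; apply: ns; exists s.
have [|v [vt nMv] vmin] := @ex_least [set v | (v = t \/ below v t) /\ ~ M v].
  by exists t; split=> //; left.
have trans_vt y : below y v -> below y t.
  by move=> yv; case: vt => [<-//|]; exact: below_trans.
have Mv y : below y v -> M y.
  move=> yv; apply: contrapT => nMy.
  have := vmin y (conj (or_intror (trans_vt _ yv)) nMy).
  by rewrite leNgt below_lt.
have agree k : below k v -> f k x = f k v.
  move=> kv; set l := u k (f k v).
  (* The successor [l] of [k] towards [v] lies in [M], so it differs from [v] and is below [v],
     hence below [t] and below [x]. *)
  have [kl fl lmin] : [/\ below k l, f k l = f k v &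
      forall l', below k l' -> f k l' = f k v -> l <= l'].
    by apply: uP; exists v.
  have Ml : M l by apply: Mnext; exact: Mv.
  have lv : l < v.
    by rewrite lt_neqAle lmin // andbT; apply/eqP => lv; apply: nMv; rewrite -lv.
  have blv : below l v.
    apply/belowE; split=> // j jl; have [->//|jk|kj] := below_comparable jl kl.
      by rewrite -(below_f jk kl) (below_f jk kv).
    have := lmin j kj; rewrite (below_f kj jl) fl => /(_ erefl).
    by rewrite leNgt below_lt.
  by rewrite -fl; apply/esym; apply: below_f kl _; apply: Lx (trans_vt _ blv).
have [xv|vx|xv] := ltgtP x v; last by apply: nMv; rewrite -xv.
  (* The predecessors of [x] are included because [agree] speaks only of nodes known to be below
     [v]. *)
  have H k : k = x \/ below k x -> below k v.
    elim: (lt_wf k) => {}k _ IH kx; apply/belowE; split.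
      by case: kx => [->//|/below_lt kx]; exact: lt_trans xv.
    move=> l lk; have lx : below l x by case: kx => [<-//|]; exact: below_trans.
    rewrite -agree; last by apply: IH; [exact: below_lt|right].
    by case: kx => [->//|]; exact: below_f.
  by apply/nxt/trans_vt/H; left.
apply: nMv; apply: Mdown Mx _; apply/belowE; split=> // k kv.
exact/esym/agree.
Qed.

(** The nodes that [tree_closed_split] yields for the members of [s] are all below [t], hence
    comparable, and the highest serves for all. The root [z] serves when [s] is empty. *)
Lemma tree_closed_escape (M : set K) t (s : seq K) : tree_closed M -> ~ M t ->
  (forall x, x \in s -> M x /\ ~ below x t) ->
  exists y, [/\ M y, below y t & forall x, x \in s -> ~ below y x].
Proof.
move=> Mcl nMt; elim: s => [_|x s IH sM].
  have [_ _ Mz] := Mcl; exists z; split=> //; apply/belowE; split.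
    by rewrite lt_neqAle zmin andbT; apply/eqP => zt; apply: nMt; rewrite -zt.
  by move=> k /below_lt; rewrite ltNge zmin.
have [|y [My yt ys]] := IH.
  by move=> w ws; apply: sM; rewrite in_cons ws orbT.
have [Mx nxt] := sM x (mem_head _ _).
have [y' [My' yt' yx']] := tree_closed_split Mcl Mx nMt nxt.
have [yy|yy|yy] := below_comparable yt yt'.
- exists y; split=> // w; rewrite in_cons => /predU1P[->|/ys//].
  by rewrite yy.
- exists y'; split=> // w; rewrite in_cons => /predU1P[->//|/ys nyw].
  by move=> /(below_trans yy).
- exists y; split=> // w; rewrite in_cons => /predU1P[->|/ys//].
  by move=> /(below_trans yy).
Qed.

(** Each closure condition starts from a single node, so countably many steps suffice. *)
Lemma tree_closed_cover (X : set K) : small X ->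
  exists M, [/\ small M, X `<=` M & tree_closed M].
Proof.
move=> sX.
pose step M := M `|` \bigcup_(x in M) ([set y | below y x] `|` [set u x true; u x false]).
pose N n := iter n step (z |` X).
exists (\bigcup_n N n); split.
- apply: small_bigcup => [|n _]; first exact: countable_small.
  elim: n => [|n IH]; first by apply: small_setU => //; exact: finite_small.
  apply: small_setU => //; apply: small_bigcup => // x _.
  by apply: small_setU; [exact: below_small|exact: finite_small].
- by move=> x Xx; exists 0%N => //; right.
- split=> [x y [n _ Ny] xy|x e [n _ Nx]|]; last by exists 0%N => //; left.
    by exists n.+1 => //; right; exists y => //; left.
  by exists n.+1 => //; right; exists x => //; right; case: e; [left|right].
Qed.

End Closed.

(** * The club of suborders given by closed sets of nodes *)

Local Notation P := (finindep below).

Definition conditions_in (M : set K) : set P := [set p | forall x, x \in val p -> M x].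

Lemma singleton_condition x : exists p : P, val p = [fset x]%fset.
Proof.
apply: finindep_ex => y y'; rewrite !in_fset1 => /eqP-> /eqP->; exact: below_irr.
Qed.

Lemma conditions_in_small M : small M -> small (conditions_in M).
Proof.
move=> /small_seqs sM.
apply: (small_inj (f := fun p : P => enum_fset (val p))) sM => [p pM|p q _ _].
  by apply/allP => x /pM Mx; exact/mem_set.
exact: finindep_enum_inj.
Qed.

Lemma finindep_card : [set: P] #<= [set: K].
Proof.
apply: (card_le_trans (B := [set: seq K])); last first.
  by apply: ranked_card; apply: ranked_seq; exact: ranked_K.
apply: (card_le_inj (f := fun p : P => enum_fset (val p))) => // p q _ _.
exact: finindep_enum_inj.
Qed.

Lemma not_layered : ~ stationarily_layered K P.
Proof.
have [u uP] := ex_next; have [z zmin] := ex_least_elt.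
pose C := [set X | exists M, [/\ small M, tree_closed u z M & X = conditions_in M]].
move=> /(_ C)[|Q [[Qreg _] [M [sM Mcl QM]]]]; first split.
- by move=> _ [M [sM _ ->]]; apply/card_ltE; exact: conditions_in_small.
- move=> X /card_ltE sX.
  have [|M [sM XM Mcl]] := @tree_closed_cover u z (\bigcup_(p in X) [set` val p]).
    by apply: small_bigcup => // p _; apply: finite_small; exact: finite_fset.
  exists (conditions_in M); first by exists M.
  by move=> p Xp x xp; apply: XM; exists p.
- move=> a x [i0 i0a] xC xmono.
  have /choice[M MP] : forall i, exists M, i < a ->
      [/\ small M, tree_closed u z M & x i = conditions_in M].
    move=> i; have [ia|] := boolP (i < a); last by exists set0.
    by have [M MP] := xC i ia; exists M.
  (* Singleton conditions recover [M i] from [conditions_in (M i)]. *)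
  have Mmono i j : i <= j -> j < a -> M i `<=` M j.
    move=> ij ja y My; have [p pE] := singleton_condition y.
    have [[_ _ xi] [_ _ xj]] := (MP _ (le_lt_trans ij ja), MP _ ja).
    have := xmono i j ij ja p; rewrite xi xj.
    by apply; [move=> y'; rewrite pE in_fset1 => /eqP->|rewrite pE in_fset1].
  exists (\bigcup_(i in [set i | i < a]) M i); split.
  + apply: small_bigcup => [|i ia]; first exact: small_segment.
    by have [] := MP i ia.
  + split=> [y y' [i ia My'] yy'|y e [i ia My]|].
    * by exists i => //; have [_ [down _ _] _] := MP i ia; exact: down My' yy'.
    * by exists i => //; have [_ [_ next _] _] := MP i ia; exact: next.
    * by exists i0 => //; have [_ [_ _ Mz] _] := MP i0 i0a.
  + apply/seteqP; split=> [p [i ia]|p pM].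
      by have [_ _ ->] := MP i ia => pM y /pM My; exists i.
    have [i ia iP] : exists2 i, i < a & forall y, y \in enum_fset (val p) -> M i y.
      have {pM} : forall y, y \in enum_fset (val p) -> exists2 i, i < a & M i y.
        by move=> y /pM[i]; exists i.
      elim: (enum_fset (val p)) => [|y s IH] scov; first by exists i0.
      have [|i ia iP] := IH; first by move=> w ws; apply: scov; rewrite in_cons ws orbT.
      have [j ja jP] := scov y (mem_head _ _).
      exists (Order.max i j) => [|w]; first by rewrite gt_max ia ja.
      have ma : Order.max i j < a by rewrite gt_max ia ja.
      rewrite in_cons => /predU1P[->|/iP].
        by apply: Mmono jP => //; rewrite le_max lexx orbT.
      by apply: Mmono => //; rewrite le_max lexx.
    by exists i => //; have [_ _ ->] := MP i ia.
have [t nMt] : exists t, ~ M t.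
  apply: contrapT => nt; apply: sM; apply: subset_card_le => t _.
  by apply: contrapT => nMt; apply: nt; exists t.
have [p pE] := singleton_condition t.
have [q Qq qred] := regular_suborder_reduct p Qreg.
rewrite QM in Qq qred.
have [w [_ /finindep_leP qw /finindep_leP pw]] := qred q Qq (lexx q).
have tw : t \in val w by apply: pw; rewrite pE in_fset1.
have [|s [Ms st sq]] := @tree_closed_escape u z uP zmin M t (val q) Mcl nMt.
  by move=> x xq; split; [exact: Qq|exact: finindepP (qw _ xq) tw].
(* Adding [s] to the reduct [q] stays inside [M] but excludes [t], as [s] is below [t]. No element
   of [q] is below [s], for it would be below [t], against the common extension [w]. *)
have [|r rE] := @finindep_ex _ below (s |` val q)%fset.
  move=> x y; rewrite !in_fset1U => /predU1P[->|xq] /predU1P[->|yq].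
  - exact: below_irr.
  - exact: sq.
  - by move=> /below_trans/(_ st); exact: finindepP (qw _ xq) tw.
  - exact: finindepP yq.
have [||w' [_ /finindep_leP rw' /finindep_leP pw']] := qred r.
- by move=> x; rewrite rE in_fset1U => /predU1P[->|/Qq].
- by apply/finindep_leP => x xq; rewrite rE in_fset1U xq orbT.
- apply: (finindepP (p := w') _ _ st).
    by apply: rw'; rewrite rE in_fset1U eqxx.
  by apply: pw'; rewrite pE in_fset1.
Qed.

End EndHomogeneousTree.

Theorem layered_weakly_compact :
  (forall (d' : Order.disp_t) (P : porderType d'), [set: P] #<= [set: K] ->
    chain_condition K P -> stationarily_layered K P) ->
  weakly_compact K.
Proof.
move=> layered; split=> // f; apply: contrapT => nohom.
apply: (@not_layered f); apply: layered; first exact: finindep_card.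
apply: finindep_chain_condition => [x|x y z'|B].
- exact: below_small.
- exact: below_comparable.
- exact: below_chain_small.
Qed.

End RegularCardinal.

Theorem theorem1p8 (d : Order.disp_t) (K : orderType d)
    (cardK : is_cardinal K) (uncK : uncountable K) (regK : regular K) :
  [<-> weakly_compact K;
       forall (d' : Order.disp_t) (P : porderType d'),
         [set: P] #<= [set: K] ->
         chain_condition K P -> stationarily_layered K P;
       forall (d' : Order.disp_t) (P : porderType d'),
         chain_condition K P -> stationarily_layered K P].
Proof.
split=> [wcK d' P _|]; first exact: weakly_compact_layered.
split=> [/(layered_weakly_compact cardK uncK regK) wcK d' P|layered].
  exact: weakly_compact_layered.
by apply: layered_weakly_compact => // d' P _; exact: layered.
Qed.
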